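(* Let $H$ be an $m\times m$ Hermitian matrix and $u,v\in\{1,\ldots,m\}$. The following are equivalent. 1. $u$ and $v$ are strongly cospectral with respect to $H$. 2. There is a unitary matrix $R$ such that $R\mathbf{e}_u=\mathbf{e}_v$, $RH=HR$, and $R=f(H)$ for some function $f$ that is analytic on its domain $D$, where each eigenvalue of $H$ is contained in $D$.
   Context: Write $H=\sum_j\lambda_jE_j$ for the spectral decomposition of $H$, where the $\lambda_j$ are the distinct eigenvalues and $E_j$ is the orthogonal projection onto the eigenspace of $\lambda_j$. $\mathbf{e}_u$ is the standard basis vector indexed by $u$. Columns $u,v$ are strongly cospectral with respect to $H$ if for each $j$ there exists $c\in\mathbb{C}$ with $|c|=1$ and $E_j\mathbf{e}_u=cE_j\mathbf{e}_v$. For a function $f$ analytic on a domain $D$ containing all $\lambda_j$, $f(H)=\sum_jf(\lambda_j)E_j$. *)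

(* Defs.v *)
From mathcomp Require Import all_boot all_order all_algebra.
From mathcomp Require Import all_classical all_reals all_analysis.
From mathcomp Require Export complex.

Set Implicit Arguments.
Unset Strict Implicit.
Unset Printing Implicit Defensive.

Import Order.TTheory GRing.Theory Num.Theory numFieldNormedType.Exports.

Local Open Scope classical_set_scope.
Local Open Scope ring_scope.
Local Open Scope sesquilinear_scope.

(* Vectors are columns, whereas [eigenspace] and [proj_ortho] act on row
   vectors; hence the two transpositions. *)
Definition eigenproj (C : numClosedFieldType) (m : nat) (H : 'M[C]_m) (a : C)
    : 'M[C]_m :=
  (proj_ortho (eigenspace H^T a))^T.

Definition spectrum (C : numClosedFieldType) (m : nat) (H : 'M[C]_m) : set C :=
  [set a | eigenvalue H a].

Definition strongly_cospectral (C : numClosedFieldType) (m : nat)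
    (H : 'M[C]_m) (u v : 'I_m) : Prop :=
  forall a : C, spectrum H a ->
    exists c : C, `|c| = 1 /\
      eigenproj H a *m delta_mx u (0 : 'I_1) =
      c *: (eigenproj H a *m delta_mx v (0 : 'I_1)).

Definition fun_mx (C : numClosedFieldType) (m : nat) (f : C -> C)
    (H : 'M[C]_m) : 'M[C]_m :=
  \sum_(a \in spectrum H) f a *: eigenproj H a.

(* Power series expansion around each point of [D]; [C^o] carries the topology
   of the norm. Values of [f] outside [D] only matter if [D] is not open. *)
Definition analytic_on (C : numClosedFieldType) (D : set C^o) (f : C^o -> C^o)
    : Prop :=
  forall z0 : C^o, D z0 -> exists a : nat -> C,
    \forall z \near z0,
      series (fun k => a k * (z - z0) ^+ k : C^o) @ \oo --> f z.

Definition domain (C : numClosedFieldType) (D : set C^o) : Prop :=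
  [/\ open D, connected D & D !=set0].

Section eigenproj_theory.
Context (C : numClosedFieldType) (m : nat) (H : 'M[C]_m) (a : C).

Lemma eigenprojP (x : 'cV[C]_m) :
  eigenproj H a *m x = x <-> H *m x = a *: x.
Proof.
have -> : (H *m x = a *: x) <-> (x^T <= eigenspace H^T a)%MS.
  split=> [e|/eigenspaceP]; first by apply/eigenspaceP; rewrite -trmx_mul e linearZ.
  by rewrite -trmx_mul -linearZ => /trmx_inj.
split=> [e|/proj_ortho_id e].
  by rewrite -e trmx_mul trmxK proj_ortho_sub.
by apply: trmx_inj; rewrite trmx_mul trmxK.
Qed.

Lemma eigenproj_idem : eigenproj H a *m eigenproj H a = eigenproj H a.
Proof. by rewrite -trmx_mul proj_ortho_proj. Qed.

Lemma eigenproj_herm : (eigenproj H a)^t* = eigenproj H a.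
Proof.
set E := eigenproj H a; set P := proj_ortho (eigenspace H^T a).
suff e : P^t* = P by rewrite /E /eigenproj -/P trmxK -[in RHS]e map_trmx trmxK.
have e : P^t* = P *m P^t*.
  have /orthomx1P : (1%:M - P <=
      orthomx Num.conj (mx_of_hermitian (hermitian1mx _)) P)%MS.
    rewrite (eqmx_ortho _ (proj_orthoE _)) -{1}[P]mul1mx.
    exact: proj_ortho_compl_sub.
  by rewrite mulmxBl mul1mx => /subr0_eq.
have e2 : P = P *m P^t*.
  by rewrite -{1}[P]trmxCK [in LHS]e trmx_mul map_mxM trmxCK.
by rewrite e -e2.
Qed.

End eigenproj_theory.

Lemma finite_spectrum (C : numClosedFieldType) (m : nat) (H : 'M[C]_m) :
  finite_set (spectrum H).
Proof.
have [r Hr] := closed_field_poly_normal (char_poly H).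
apply: (@sub_finite_set _ _ [set` r]) (finite_seq r) => a /=.
rewrite /spectrum/= eigenvalue_root_char Hr (monicP (char_poly_monic H)).
by rewrite scale1r root_prod_XsubC.
Qed.

Lemma spectral_decomposition (C : numClosedFieldType) (m : nat) (H : 'M[C]_m) :
  H \is hermsymmx -> H = \sum_(a \in spectrum H) a *: eigenproj H a.
Proof.
move=> Hh; set K := H^T.
have KE : H = map_mx Num.conj K.
  by rewrite {1}(is_hermitianmxP _ _ _ Hh) scale1r.
have Kh : K \is hermsymmx.
  by apply/is_hermitianmxP; rewrite scale1r trmxK KE map_mxCK.
have := orthomx_spectralP (hermitian_normalmx Kh).
have := hermitian_spectral_diag_real Kh.
set P := spectralmx _; set d := spectral_diag _ => dreal KP.
have Pu : P \is unitarymx := spectral_unitarymx _.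
have rowPK i : row i P *m K = d 0 i *: row i P.
  rewrite -row_mul KP !mulmxA mulmxV ?mul1mx ?unitarymx_unit//.
  by rewrite row_mul row_diag_mx -scalemxAl -rowE.
have rowP0 i : row i P != 0.
  apply/eqP => /(congr1 (mulmx^~ (invmx P))); rewrite mul0mx -row_mul.
  rewrite mulmxV ?unitarymx_unit// => /rowP/(_ i); rewrite !mxE eqxx.
  by move/eqP; rewrite oner_eq0.
have rowE0 i a : a != d 0 i -> row i P *m proj_ortho (eigenspace K a) = 0.
  move=> ai; apply: proj_ortho_0; apply/orthomx1P.
  set V := eigenspace _ _.
  have VK : V *m K = a *: V by apply/eigenspaceP.
  clearbody V.
  have KV : K *m V^t* = a^* *: V^t*.
    have -> : a^* *: V^t* = (a *: V)^t* by rewrite linearZ map_mxZ.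
    rewrite -VK trmx_mul map_mxM {1}(is_hermitianmxP _ _ _ Kh).
    by rewrite scale1r.
  have [areal|anr] := eqVneq a^* a.
    have : (row i P *m K) *m V^t* = row i P *m (K *m V^t*) by rewrite mulmxA.
    rewrite rowPK KV areal -scalemxAl -scalemxAr => /eqP.
    rewrite -subr_eq0 -scalerBl scaler_eq0 subr_eq0 eq_sym (negbTE ai) /=.
    by move/eqP.
  have : (V *m K) *m V^t* = V *m (K *m V^t*) by rewrite mulmxA.
  rewrite VK KV -scalemxAl -scalemxAr => /eqP.
  rewrite -subr_eq0 -scalerBl scaler_eq0 subr_eq0 eq_sym (negbTE anr) /=.
  move=> /eqP/orthomx1P/orthomx_disj => V0.
  have /capmx_idPl := submx_refl V; rewrite V0 => /eqmxP/andP[_].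
  by rewrite submx0 => /eqP->; rewrite trmx0 map_mx0 mulmx0.
have dspec i : spectrum H (d 0 i).
  apply/eigenvalueP; exists (map_mx Num.conj (row i P)).
    rewrite KE -map_mxM rowPK map_mxZ; congr (_ *: _).
    by have /mxOverP/(_ 0 i)/CrealP := dreal.
  by rewrite map_mx_eq0.
rewrite (fsbig_finite _ _ (finite_spectrum H)).
apply: trmx_inj; apply: (@row_full_inj _ _ _ _ P).
  by rewrite row_full_unit unitarymx_unit.
apply/row_matrixP => i; rewrite !row_mul rowPK linear_sum mulmx_sumr.
rewrite (bigD1_seq (d 0 i)) ?fset_uniq ?in_fset_set ?inE//=; last exact: finite_spectrum.
rewrite big1 ?addr0 => [|a ai]; rewrite linearZ /= /eigenproj trmxK -scalemxAr.
  by rewrite proj_ortho_id//; apply/eigenspaceP; rewrite rowPK.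
by rewrite rowE0 ?scaler0.
Qed.

(* Main.v *)
Require Import Defs.
From mathcomp Require Import all_boot all_order all_algebra.
From mathcomp Require Import all_classical all_reals all_analysis.
Import Order.TTheory GRing.Theory Num.Theory numFieldNormedType.Exports.
Local Open Scope classical_set_scope.
Local Open Scope ring_scope.

(** Let [E a] be the projection onto the eigenspace of [a]. Since [H] is
    Hermitian, the [E a] are pairwise orthogonal ([eigenproj_orth]) and, over
    the spectrum, sum to the identity ([sum_eigenproj]). A matrix is therefore
    determined by its products with the [E a] ([eigenproj_inj]), and
    [fun_mx f H] acts on the range of [E a] as multiplication by [f a]
    ([eigenproj_fun_mx]).

    It follows that [U := fun_mx f H] commutes with [H], that it is unitary
    exactly when [f] has modulus 1 wherever [E a] is nonzero
    ([fun_mx_unitary]), and that it sends [e_u] to [e_v] exactly when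
    [E a e_v = f a *: E a e_u] for every [a] ([fun_mx_mulP]). The
    existence of an arbitrary function [f] meeting the last two conditions is
    strong cospectrality, with phases [(f a)^-1].

    Given strong cospectrality, it remains to choose an analytic [f] with
    prescribed values at the finitely many eigenvalues: an interpolation
    polynomial serves ([polynomial_interpolation]), on the whole plane, which
    is a domain ([complex_connected]). *)

Lemma col_ext (T : Type) m n (A B : 'M[T]_(m, n)) :
  (forall j, col j A = col j B) -> A = B.
Proof.
by move=> AB; apply/matrixP => i j; move/colP/(_ i): (AB j); rewrite !mxE.
Qed.

Section functional_calculus.
Local Open Scope sesquilinear_scope.
Context {C : numClosedFieldType} {m : nat} {H : 'M[C]_m}.
Local Notation E := (eigenproj H).

Lemma mulmx_eigenproj a : H *m E a = a *: E a.
Proof.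
apply/col_ext => j.
rewrite !colE -mulmxA -scalemxAl; apply/eigenprojP.
by rewrite mulmxA eigenproj_idem.
Qed.

Lemma eigenproj_id n a (A : 'M[C]_(m, n)) : H *m A = a *: A -> E a *m A = A.
Proof.
move=> HA; apply/col_ext => j.
by rewrite !colE -mulmxA; apply/eigenprojP; rewrite mulmxA HA scalemxAl.
Qed.

Context (hH : H \is hermsymmx).

Lemma hermsym_trmxC : H^t* = H.
Proof. by rewrite [RHS](is_hermitianmxP _ _ _ hH) expr0 scale1r. Qed.

(** The adjoint of [H *m E a = a *: E a] only gives the conjugate of [a] on
    the right; the two factors have the same action on [E a], because
    [E a *m H *m E a] can be computed from either side. *)
Lemma eigenproj_mulmx a : E a *m H = a *: E a.
Proof.
have EH : E a *m H = a^* *: E a.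
  have : (H *m E a)^t* = (a *: E a)^t* by rewrite mulmx_eigenproj.
  by rewrite trmx_mul map_mxM linearZ map_mxZ /= eigenproj_herm hermsym_trmxC.
rewrite EH -eigenproj_idem scalemxAl -EH -mulmxA mulmx_eigenproj.
by rewrite -scalemxAr.
Qed.

(** The rows of [E a] are left eigenvectors of [H] for [a]. *)
Lemma eigenproj_eq0 a : ~ spectrum H a -> E a = 0.
Proof.
move=> aH; apply/eqP; rewrite -submx0.
have /eqP <- : eigenspace H a == 0 by apply: contra_notT aH.
by apply/eigenspaceP/eigenproj_mulmx.
Qed.

Lemma eigenproj_orth a b : a != b -> E a *m E b = 0.
Proof.
move=> ab; have : E a *m H *m E b = E a *m (H *m E b) by rewrite mulmxA.
rewrite eigenproj_mulmx mulmx_eigenproj -scalemxAl -scalemxAr => /eqP.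
by rewrite -subr_eq0 -scalerBl scaler_eq0 subr_eq0 (negbTE ab) => /eqP.
Qed.

(** This holds for every [a]: off the spectrum both sides vanish. *)
Lemma eigenproj_fun_mx f a : E a *m fun_mx f H = f a *: E a.
Proof.
rewrite /fun_mx (fsbig_finite _ _ (finite_spectrum H)) mulmx_sumr.
have EE b : b != a -> E a *m (f b *: E b) = 0.
  by move=> ba; rewrite -scalemxAr eigenproj_orth ?scaler0// eq_sym.
have [aH|aH] := pselect (spectrum H a); last first.
  rewrite eigenproj_eq0// scaler0 big1// => b _.
  by rewrite mul0mx.
rewrite (bigD1_seq a) ?finmap.fset_uniq ?in_fset_set ?inE//=; last first.
  exact: finite_spectrum.
by rewrite big1 ?addr0// -scalemxAr eigenproj_idem.
Qed.

(** Write [S] for the sum. By orthogonality every [E a] kills [1%:M - S];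
    then so does [H], being a combination of the [E a]. Hence the columns of
    [1%:M - S] lie in the kernel of [H] and are fixed by [E 0], which also
    kills them. *)
Lemma sum_eigenproj : \sum_(a \in spectrum H) E a = 1%:M.
Proof.
set S := LHS.
have ES a : E a *m S = E a.
  rewrite -[RHS]scale1r -(eigenproj_fun_mx (fun=> 1)) /fun_mx.
  by congr (_ *m _); apply: eq_fsbigr => b _; rewrite scale1r.
have E1S a : E a *m (1%:M - S) = 0 by rewrite mulmxBr mulmx1 ES subrr.
apply/esym/eqP; rewrite -subr_eq0 -(E1S 0) eq_sym; apply/eqP/eigenproj_id.
rewrite scale0r {1}(spectral_decomposition hH).
rewrite (fsbig_finite _ _ (finite_spectrum H)) mulmx_suml big1// => a _.
by rewrite -scalemxAl E1S scaler0.
Qed.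

(** Comparing components in the eigenspaces reduces identities between
    functions of [H] to identities between scalars. *)
Lemma eigenproj_inj n (A B : 'M[C]_(m, n)) :
  (forall a, E a *m A = E a *m B) -> A = B.
Proof.
move=> AB; rewrite -[A]mul1mx -[B]mul1mx -sum_eigenproj.
rewrite (fsbig_finite _ _ (finite_spectrum H)) !mulmx_suml.
by apply: eq_bigr => a _.
Qed.

Lemma fun_mxC f : fun_mx f H *m H = H *m fun_mx f H.
Proof.
apply: eigenproj_inj => a; rewrite !mulmxA eigenproj_fun_mx eigenproj_mulmx.
by rewrite -!scalemxAl eigenproj_fun_mx eigenproj_mulmx !scalerA mulrC.
Qed.

Lemma trmxC_fun_mx f : (fun_mx f H)^t* = fun_mx (fun a => (f a)^*) H.
Proof.
rewrite /fun_mx !(fsbig_finite _ _ (finite_spectrum H)) !linear_sum raddf_sum.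
by apply: eq_bigr => a _; rewrite /= linearZ /= map_mxZ eigenproj_herm.
Qed.

(** Only the values of [f] at the [a] with [E a != 0] are constrained, since
    [E a *m U *m U^t*] is [`|f a| ^+ 2 *: E a] for [U := fun_mx f H]. *)
Lemma fun_mx_unitary f :
  fun_mx f H \is unitarymx <-> forall a, E a != 0 -> `|f a| = 1.
Proof.
have EfmxfmxC a : E a *m (fun_mx f H *m (fun_mx f H)^t*) = `|f a| ^+ 2 *: E a.
  rewrite trmxC_fun_mx mulmxA eigenproj_fun_mx -scalemxAl eigenproj_fun_mx.
  by rewrite scalerA normCK.
split=> [/unitarymxP U1 a /negbTE E0|f1].
  have /eqP := EfmxfmxC a; rewrite U1 mulmx1 -{1}[E a]scale1r -subr_eq0.
  by rewrite -scalerBl scaler_eq0 E0 orbF subr_eq0 eq_sym sqrp_eq1// => /eqP.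
apply/unitarymxP/eigenproj_inj => a; rewrite EfmxfmxC mulmx1.
by have [->|/f1->] := eqVneq (E a) 0; rewrite ?scaler0// expr1n scale1r.
Qed.

Lemma fun_mx_mulP f (x y : 'cV[C]_m) :
  fun_mx f H *m x = y <-> forall a, E a *m y = f a *: (E a *m x).
Proof.
split=> [<- a|xy]; first by rewrite mulmxA eigenproj_fun_mx scalemxAl.
by apply: eigenproj_inj => a; rewrite mulmxA eigenproj_fun_mx xy scalemxAl.
Qed.

End functional_calculus.

(** The nodes are added one by one, as in Newton's scheme: a multiple of the
    polynomial vanishing at the former nodes corrects the value at the new
    one. *)
Lemma polynomial_interpolation {F : fieldType} (A : set F) (c : F -> F) :
  finite_set A -> exists p : {poly F}, forall a, A a -> p.[a] = c a.
Proof.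
move=> /finite_seqP[s ->{A}] /=; elim: s => [|a s [p ps]]; first by exists 0.
have [as_|as_] := boolP (a \in s).
  by exists p => b; rewrite inE => /predU1P[->|]; apply: ps.
pose w := \prod_(b <- s) ('X - b%:P).
have wa : w.[a] != 0 by rewrite -rootE root_prod_XsubC.
exists (p + ((c a - p.[a]) / w.[a]) *: w) => b.
rewrite inE hornerD hornerZ => /predU1P[->|bs].
  by rewrite divfK// addrC subrK.
have /rootP-> : root w b by rewrite root_prod_XsubC.
by rewrite mulr0 addr0 ps.
Qed.

(** The Taylor expansion of a polynomial is a finite sum, so the partial sums
    of the power series are eventually constant. *)
Lemma horner_analytic (C : numClosedFieldType) (D : set C^o) (p : {poly C}) :
  analytic_on D (fun z => p.[z]).
Proof.
move=> z0 _; exists (fun k => p^`N(k).[z0]); near=> z.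
apply: cvg_near_cst; exists (size p) => // n /= pn.
rewrite /series/= big_mkord -[z in RHS](subrKC z0).
by rewrite (nderiv_taylor_wide _ pn)//; exact: mulrC.
Unshelve. all: by end_near. Qed.

(** The topology of [R[i]^o] comes from a norm with values in [R[i]] itself;
    the radius of a ball is thus a complex number, and its positivity forces
    it to be real. *)
Lemma real_complex_continuous (R : realType) :
  continuous (real_complex R : R -> R[i]^o).
Proof.
move=> t; apply/cvgrPdist_lt => -[e e'] e0.
have {e0} /andP[/eqP e'0 e0] : (e' == 0) && (0 < e) by move: e0; rewrite ltcE.
near=> s; rewrite -rmorphB normc_def /= expr0n addr0 sqrtr_sqr e'0 ltcR.
by near: s; apply: cvgr_dist_lt => //; exact: cvg_id.
Unshelve. all: by end_near. Qed.

(** The plane is the union of the segments joining [0] to its points. *)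
Lemma complex_connected (R : realType) : connected [set: R[i]^o].
Proof.
have -> : [set: R[i]^o] =
    \bigcup_(z in [set: R[i]^o])
      ((fun t : R => t%:C%C * z : R[i]^o) @` `[0, 1]).
  apply/seteqP; split=> // z _; exists z => //; exists 1; rewrite ?mul1r//.
  by rewrite /= in_itv /= ler01 lexx.
apply: bigcup_connected => [|z _].
  exists 0 => z _; exists 0; rewrite ?mul0r//.
  by rewrite /= in_itv /= ler01 lexx.
apply: connected_continuous_connected; first exact: segment_connected.
apply: continuous_subspaceT => t.
apply: (cvg_comp (real_complex R : R -> R[i]^o) ( *%R^~ z)); last first.
  exact: mulrr_continuous.
exact: real_complex_continuous.
Qed.

Theorem theorem3p2 (R : realType) (m : nat) (H : 'M[R[i]]_m) (u v : 'I_m)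
    (hH : H \is hermsymmx) :
  strongly_cospectral H u v <->
  exists U : 'M[R[i]]_m,
    [/\ U \is unitarymx,
        U *m delta_mx u (0 : 'I_1) = delta_mx v 0,
        U *m H = H *m U &
        exists (D : set R[i]^o) (f : R[i]^o -> R[i]^o),
          [/\ domain D, analytic_on D f, spectrum H `<=` D & U = fun_mx f H]].
Proof.
split=> [sc|[U [Uu Uuv _ [D [f [_ _ _ Uf]]]]] a _]; last first.
  move: Uu Uuv; rewrite {}Uf => /(fun_mx_unitary hH) f1 /(fun_mx_mulP hH) Euv.
  (* If [E a = 0] there is no constraint on [f a], and any phase will do. *)
  have [->|/f1 fa1] := eqVneq (eigenproj H a) 0.
    by exists 1; rewrite normr1 !mul0mx scaler0.
  have fa0 : f a != 0 by rewrite -normr_gt0 fa1 ltr01.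
  exists (f a)^-1; rewrite normfV fa1 invr1; split=> //.
  by rewrite Euv scalerA mulVf// scale1r.
have /choice[c cP] : forall a : R[i], exists c : R[i], spectrum H a ->
    `|c| = 1 /\ eigenproj H a *m delta_mx u (0 : 'I_1) =
      c *: (eigenproj H a *m delta_mx v (0 : 'I_1)).
  move=> a; have [/sc[c]|aH] := pselect (spectrum H a); first by exists c.
  by exists 0.
have [p pP] :=
  polynomial_interpolation _ (fun a => (c a)^-1) (finite_spectrum H).
exists (fun_mx (horner p) H); split.
- apply/(fun_mx_unitary hH) => a Ea; have aH : spectrum H a.
    by apply: contra_notP (elimN eqP Ea); exact: eigenproj_eq0.
  by rewrite pP// normfV (cP a aH).1 invr1.
- apply/(fun_mx_mulP hH) => a.
  have [aH|/(eigenproj_eq0 hH)->] := pselect (spectrum H a); last first.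
    by rewrite !mul0mx scaler0.
  have [c1 ->] := cP a aH; rewrite pP// scalerA mulVf ?scale1r//.
  by rewrite -normr_gt0 c1 ltr01.
- exact: fun_mxC.
- exists setT, (horner p); split => //; last exact: horner_analytic.
  by split; [exact: openT|exact: complex_connected|exists 0].
Qed.
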